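(* Let $\mu$ be a Borel probability measure on $\mathbb{R}$ with compact support such that ${\rm supp}(\mu)$ has a finite number $n$ of connected components. Then for every $\varepsilon>0$ there exist real-valued $x,y\in L^\infty(0,1)$ (with respect to Lebesgue measure on $(0,1)$) such that: (1) $\|x-y\|_\infty<\varepsilon$; (2) the distribution of $x$ is $\mu$; (3) the distribution $\nu$ of $y$ is supported on a union of $n$ pairwise disjoint intervals $[a_j,b_j]$, $j=1,\dots,n$, $\nu$ is absolutely continuous, and its density $\rho$ satisfies \[c_j\sqrt{(t-a_j)(b_j-t)}\le\rho(t)\le C_j\sqrt{(t-a_j)(b_j-t)},\quad t\in[a_j,b_j],\] for some constants $c_j,C_j>0$.
   Context: The distribution of a measurable function $f$ on $(0,1)$ is the pushforward of Lebesgue measure on $(0,1)$ under $f$. *)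

(* Defs.v *)
From HB Require Import structures.
From mathcomp Require Import all_boot all_order all_algebra.
From mathcomp Require Import all_classical all_reals all_analysis.
From mathcomp Require Import ess_sup_inf.
Set Implicit Arguments. Unset Strict Implicit. Unset Printing Implicit Defensive.
Import Order.TTheory GRing.Theory Num.Theory.
Import numFieldNormedType.Exports.
Local Open Scope classical_set_scope.
Local Open Scope ring_scope.

Definition msupport {R : realType} (m : set R -> \bar R) : set R :=
  [set t | forall e : R, 0 < e -> (0 < m (ball t e))%E].

Definition components {R : realType} (S : set R) : set (set R) :=
  [set connected_component S t | t in S].

Definition leb01 {R : realType} :=
  mrestr (@lebesgue_measure R) (measurable_itv `]0%R, 1%R[).

Definition distr01 {R : realType} (f : R -> R) : set R -> \bar R :=
  pushforward (@leb01 R) f.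

Definition Linf01 {R : realType} (f : R -> R) : \bar R :=
  ess_sup (@leb01 R) (fun t => (`|f t|)%:E).

Definition is_Linf01 {R : realType} (f : R -> R) : Prop :=
  measurable_fun (`]0%R, 1%R[ : set R) f /\ (Linf01 f < +oo)%E.

(* Main.v *)
Require Import Defs.
From HB Require Import structures.
From mathcomp Require Import all_boot all_order all_algebra.
From mathcomp Require Import all_classical all_reals all_analysis.
From mathcomp Require Import ess_sup_inf.
From mathcomp Require Import measurable_realfun lra.
Import Order.TTheory GRing.Theory Num.Theory.
Import numFieldNormedType.Exports.
Local Open Scope classical_set_scope.
Local Open Scope ring_scope.
Local Open Scope card_scope.

(** The components of [K := supp mu] are compact intervals [[al j, be j]].  For
    small [d], the enlarged intervals [[a j, b j] := [al j - d, be j + d]] are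
    still disjoint.  Let [w] be the sum of the semicircles over them and let
    [r := eps / 2].  Spreading the mass of [mu] at each point [u] over the ball
    of radius [r] around [u], proportionally to [w], gives a probability [nu]
    with density [rho t = w t * \int_(|u - t| < r) dmu(u) / V(u)], where [V(u)]
    is the integral of [w] over that ball.  The second factor is bounded above
    because [V] is bounded away from [0] on [K], and bounded below because, by
    compactness, balls of radius [r / 2] centered in [K] have [mu]-mass bounded
    away from [0].  No mass moves by more than [r], so the cumulative
    distribution functions of [mu] and [nu] agree up to a shift by [r] of the
    argument, and hence the quantile functions [x] of [mu] and [y] of [nu]
    satisfy [|x - y| <= r]. *)

(** * Lebesgue measure on the unit interval as a probability *)

Section leb01_probability.
Context {R : realType}.

Let leb01T : @leb01 R setT = 1%E.
Proof.
by rewrite /leb01 /mrestr setTI lebesgue_measure_itv/= lte_fin ltr01 sube0.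
Qed.

HB.instance Definition _ := Measure.on (@leb01 R).
HB.instance Definition _ :=
  @Measure_isProbability.Build _ _ R (@leb01 R) leb01T.

End leb01_probability.

(** * Limits and right continuity of cumulative distribution functions *)

Section cumulative_distribution.
Context {R : realType} (P : probability R R).
Local Open Scope ereal_scope.

(** The identity has distribution [P] under [P], so the facts on [cdf] of random variables carry
    over to [P] itself. *)
Let idR : R -> R := idfun.

#[local] HB.instance Definition _ :=
  @isMeasurableFun.Build _ _ R R idR (@measurable_id _ _ setT).

Lemma cvg_itvNycy1 : P `]-oo, r]%classic @[r --> +oo%R] --> 1.
Proof. exact: (cvg_cdfy1 (idR : {RV P >-> R})). Qed.

Lemma cvg_itvNycNy0 : P `]-oo, r]%classic @[r --> -oo%R] --> 0.
Proof. exact: (cvg_cdfNy0 (idR : {RV P >-> R})). Qed.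

Lemma itvNyc_right_continuous a :
  P `]-oo, r]%classic @[r --> a^'+] --> P `]-oo, a]%classic.
Proof. exact: (@cdf_right_continuous _ _ _ P idR a). Qed.

End cumulative_distribution.

(** * Quantile functions and their distribution *)

Section quantile.
Context {R : realType}.
Implicit Types P Q : probability R R.

Definition quantile P (u : R) : R :=
  inf [set t | (u%:E <= P `]-oo, t]%classic)%E].

(** The limits at both infinities make the set nonempty and bounded below for [u] in []0, 1[]; right
    continuity of the distribution function then makes its infimum a minimum. *)
Lemma quantile_le P u t : 0 < u < 1 ->
  (quantile P u <= t) = (u%:E <= P `]-oo, t]%classic)%E.
Proof.
move=> /andP[u0 u1]; set S := [set t | (u%:E <= P `]-oo, t]%classic)%E].
pose F t := fine (P `]-oo, t]%classic).
have SE s : S s <-> u <= F s.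
  by rewrite /S /F/= -[P _]fineK ?fin_num_measure// lee_fin.
have mono s s' : s <= s' -> F s <= F s'.
  move=> ss'; rewrite fine_le ?fin_num_measure//.
  by rewrite le_measure ?inE//; exact: subitvPr.
have S0 : S !=set0.
  have /fine_cvg Fy := cvg_itvNycy1 P.
  have [s /ltW/SE] := filter_ex (cvgr_gt _ Fy u u1); by exists s.
have Slb : has_lbound S.
  have /fine_cvg FNy := cvg_itvNycNy0 P.
  have [s Fs] := filter_ex (cvgr_lt _ FNy u u0).
  exists s => r /SE uFr; rewrite leNgt; apply/negP => rs.
  by have := le_lt_trans (le_trans uFr (mono _ _ (ltW rs))) Fs; rewrite ltxx.
rewrite /quantile -/S; apply/idP/idP => [qt|ut]; last exact: ge_inf.
apply/SE; apply: (le_trans _ (mono _ _ qt)); rewrite leNgt; apply/negP => Fu.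
have Frc : F r @[r --> (inf S)^'+] --> F (inf S).
  apply: fine_cvg; rewrite fineK ?fin_num_measure//.
  exact: itvNyc_right_continuous.
have [r [qr Fr]] : exists r, inf S < r /\ F r < u.
  apply: (@filter_ex _ ((inf S)^'+)); apply: filterI.
    exact: nbhs_right_gt.
  exact: (cvgr_lt _ Frc).
have [s Ss sr] := inf_lt S0 qr.
have /SE uFs := Ss.
by have := le_lt_trans (le_trans uFs (mono _ _ (ltW sr))) Fr; rewrite ltxx.
Qed.

Lemma quantile_homo P : {in `]0, 1[ &, {homo quantile P : s t / s <= t}}.
Proof.
move=> s t; rewrite !in_itv/= => s01 t01 st; rewrite quantile_le//.
by apply: (@le_trans _ _ t%:E); rewrite ?lee_fin// -quantile_le.
Qed.

(** By monotonicity the preimages of the rays [[r, +oo[] are intervals. *)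
Lemma measurable_quantile P : measurable_fun (`]0, 1[ : set R) (quantile P).
Proof.
apply: (measurability (@RGenCInfty.G R)) => [|/= _ [_] [r] -> <-].
  exact: RGenCInfty.measurableE.
apply: is_interval_measurable => s t/= [s01 rs] [t01 _] u /andP[su ut].
have u01 : u \in `]0, 1[.
  move: s01 t01; rewrite !in_itv/= => /andP[s0 _] /andP[_ t1].
  by rewrite (lt_le_trans s0)// (le_lt_trans ut).
split=> //; move: rs; rewrite !in_itv/= !andbT => /le_trans; apply.
exact: quantile_homo.
Qed.

(** The complementary rays []x, +oo[] are stable under intersection and generate the Borel sets. *)
Lemma probability_eq_itvNyc P Q :
  (forall t, P `]-oo, t]%classic = Q `]-oo, t]%classic) ->
  forall A, measurable A -> P A = Q A.
Proof.
move=> PQ A mA.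
apply: (@measure_unique _ _ R [set A | exists x : R, A = `]x, +oo[%classic]
  (fun k : nat => `](- k%:R : R), +oo[%classic) _ _ _ _ P Q) => //.
- exact: RGenOInfty.measurableE.
- move=> _ _ [x ->] [y ->]; exists (Num.max x y).
  apply/seteqP; split => z; rewrite /= !in_itv/= !andbT gt_max.
    by move=> [-> ->].
  by move=> /andP[].
- by move=> k; exists (- k%:R).
- rewrite -subTset => t _; exists (Num.truncn (- t)).+1 => //=.
  by rewrite in_itv/= andbT ltrNl truncnS_gt.
- move=> _ [x ->].
  have PC (P' : probability R R) :
      P' `]x, +oo[%classic = (1 - P' `]-oo, x]%classic)%E.
    by rewrite -setCitvl; exact: probability_setC.
  by rewrite -[LHS]/(P _) -[RHS]/(Q _) !PC PQ.
- by move=> k; rewrite (le_lt_trans (probability_le1 _ _)) ?ltry.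
Qed.

(** By [quantile_le], the [u] in []0, 1[] with quantile at most [t] form an interval from [0] to
    [P ]-oo, t]], so both distribution functions agree. *)
Lemma quantile_distr P A : measurable A -> distr01 (quantile P) A = P A.
Proof.
move: A.
(* Extension by [0] outside []0, 1[] gives a random variable on the whole line with the same
   distribution under [leb01]. *)
pose q := quantile P \_ `]0, 1[%classic.
have mq : measurable_fun [set: measurableTypeR R] (q : _ -> R).
  apply/(measurable_restrictT _ _).1 => //.
  exact: measurable_quantile.
pose q_ := isMeasurableFun.Build _ _ (measurableTypeR R) R q mq.
pose X : {mfun measurableTypeR R >-> R} := HB.pack q q_.
have qX A : distr01 (quantile P) A = distribution (@leb01 R) X A.
  rewrite /distr01 /distribution /pushforward /leb01 /mrestr.
  congr lebesgue_measure.
  by apply/seteqP; split => x [/= + x01]; rewrite /q patchE mem_set.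
move=> A mA; rewrite qX; apply: probability_eq_itvNyc => // t {A mA}.
have Pt0 : 0 <= fine (P `]-oo, t]%classic) by rewrite fine_ge0.
have Pt1 : fine (P `]-oo, t]%classic) <= 1.
  by rewrite -lee_fin fineK ?fin_num_measure// probability_le1.
rewrite -[LHS]qX /distr01 /pushforward /leb01 /mrestr.
set p := fine _ in Pt0 Pt1 *.
have pE : P `]-oo, t]%classic = p%:E by rewrite fineK ?fin_num_measure.
(* For [p = 1] the right end is open, since [1] is outside the domain. *)
have -> : quantile P @^-1` `]-oo, t] `&` `]0, 1[ =
    [set` Interval (BRight 0) (if p == 1 then BLeft 1 else BRight p)].
  apply/seteqP; split => u /=.
    rewrite !in_itv/= => -[+ /andP[u0 u1]].
    rewrite quantile_le ?u0// pE lee_fin => up.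
    by case: ifP.
  case: ifPn => [/eqP p1|p1]; rewrite !in_itv/= => /andP[u0 up].
    by rewrite quantile_le ?u0// pE lee_fin p1 ltW.
  have u1 : u < 1 by rewrite (le_lt_trans up)// lt_neqAle p1.
  by rewrite quantile_le ?u0// pE lee_fin.
rewrite pE; case: ifPn => [/eqP ->|p1]; rewrite lebesgue_measure_itv/= lte_fin.
  by rewrite ltr01 sube0.
case: ifPn => [_|]; first by rewrite sube0.
by rewrite -leNgt => p0; congr EFin; apply/le_anti; rewrite Pt0.
Qed.

End quantile.

(** * Uniform bounds for quantile functions *)

Section quantile_comparison.
Context {R : realType}.
Implicit Types P Q : probability R R.

(** If [P ]-oo, s]] is at least [u], so is [Q ]-oo, s + r]]; taking for [s] the quantile of [P]
    gives one inequality, and exchanging [P] and [Q] the other. *)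
Lemma quantile_dist P Q (r u : R) : 0 < u < 1 ->
  (forall s, (P `]-oo, s]%classic <= Q `]-oo, (s + r)%R]%classic)%E) ->
  (forall s, (Q `]-oo, s]%classic <= P `]-oo, (s + r)%R]%classic)%E) ->
  `|quantile P u - quantile Q u| <= r.
Proof.
move=> u01 PQ QP.
have QP' : quantile Q u <= quantile P u + r.
  by rewrite quantile_le// (le_trans _ (PQ _))// -quantile_le.
have PQ' : quantile P u <= quantile Q u + r.
  by rewrite quantile_le// (le_trans _ (QP _))// -quantile_le.
by rewrite ler_norml; apply/andP; split; lra.
Qed.

(** The distribution function is [0] to the left of [- B] and [1] at [B]. *)
Lemma quantile_norm_le P (B u : R) : 0 < u < 1 ->
  P.-negligible (~` `[- B, B]%classic) -> `|quantile P u| <= B.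
Proof.
move=> u01 PB; have /andP[u0 u1] := u01.
have PB0 : P (~` `[- B, B]%classic) = 0%E.
  by apply: measure_negligible => //; exact: measurableC.
have P0 A : measurable A -> A `<=` ~` `[- B, B]%classic -> P A = 0%E.
  by move=> mA AB; apply: (subset_measure0 _ _ AB) => //; exact: measurableC.
rewrite ler_norml; apply/andP; split.
  rewrite leNgt; apply/negP => uB.
  have := quantile_le P u (quantile P u) u01.
  rewrite lexx P0//; first by rewrite lee_fin leNgt u0.
  move=> s /=; rewrite !in_itv/= => su; apply/negP; rewrite negb_and -ltNge.
  by rewrite (le_lt_trans su).
rewrite quantile_le ?u0//.
have : P (~` `]-oo, B]%classic) = 0%E.
  apply: P0; first exact: measurableC.
  move=> s /=; rewrite !in_itv/= => /negP sB; apply/negP.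
  by rewrite negb_and sB orbT.
have := @probability_setC _ _ _ P `]-oo, B]%classic.
move=> -> //; rewrite -[P _]fineK ?fin_num_measure//.
rewrite -EFinB => -[] /eqP; rewrite subr_eq0 => /eqP <-.
by rewrite lee_fin ltW.
Qed.

Lemma ae_leb01 (Q : R -> Prop) : (forall t, 0 < t < 1 -> Q t) ->
  {ae @leb01 R, forall t, Q t}.
Proof.
move=> Q01; exists (~` `]0, 1[%classic); split; first exact: measurableC.
  by rewrite /leb01 /mrestr setICl measure0.
by move=> t /= NQ; rewrite in_itv/= => /Q01.
Qed.

Lemma Linf01_le (f : R -> R) (B : R) :
  (forall t, 0 < t < 1 -> `|f t| <= B) -> (Linf01 f <= B%:E)%E.
Proof.
move=> fB; apply/ess_supP; apply: ae_leb01 => t /fB.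
by rewrite lee_fin.
Qed.

End quantile_comparison.


(** * The support, its components and their enlargement *)

Section topology_of_the_support.
Context {R : realType}.
Implicit Types (mu : probability R R) (K C : set R).

(** Each point off the support lies in a null interval with rational endpoints, and there are
    countably many of these. *)
Lemma negligible_setC_msupport mu : mu.-negligible (~` msupport mu).
Proof.
pose G (pq : rat * rat) : set R := if mu `]ratr pq.1, ratr pq.2[%classic == 0%E
  then `]ratr pq.1, ratr pq.2[%classic else set0.
have GN pq : mu.-negligible (G pq).
  rewrite /G; case: ifP => [/eqP mu0|_]; last exact: negligible_set0.
  exact/negligibleP.
(* The family indexed by pairs of rationals is turned into a sequence; naturals that code no pair
   get the empty set. *)
have [F [FN GF]] : exists F : nat -> set R,
    (forall k, mu.-negligible (F k)) /\ (forall pq, G pq `<=` \bigcup_k F k).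
  exists (fun k => if unpickle k is Some pq then G pq else set0).
  split => [k|pq].
    by case: unpickle => [pq|]; [exact: GN|exact: negligible_set0].
  apply: subset_trans (bigcup_sup (i := pickle pq) I).
  by rewrite pickleK.
apply: (@negligibleS _ _ _ _ (\bigcup_k F k)); last exact: negligible_bigcup.
move=> t /=; rewrite /msupport/= => /existsNP[e /not_implyP[e0 /negP]].
rewrite -leNgt => mu0.
have [|p] := @rat_in_itvoo R (t - e) t; first by rewrite ltrBlDr ltrDl.
have [|q] := @rat_in_itvoo R t (t + e); first by rewrite ltrDl.
rewrite !in_itv/= => /andP[tq qt] /andP[pt tp].
apply: (GF (p, q)).
rewrite /G ifT/= ?in_itv/= ?tp//.
rewrite eq_le measure_ge0 andbT (le_trans _ mu0)//.
rewrite le_measure ?inE//; first exact: measurable_ball.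
move=> s /=; rewrite in_itv/= => /andP[ps sq]; rewrite ball_itv/= in_itv/=.
by rewrite (lt_trans pt ps) (lt_trans sq qt).
Qed.

Lemma seq_pos_lbound (I : eqType) (s : seq I) (f : I -> R) :
  {in s, forall i, 0 < f i} -> exists2 d, 0 < d & {in s, forall i, d <= f i}.
Proof.
elim: s => [_|i s IHs f0]; first by exists 1.
have [j js|d d0 df] := IHs; first by rewrite f0// inE js orbT.
exists (Num.min (f i) d) => [|j]; first by rewrite lt_min d0 f0 ?mem_head.
rewrite inE => /predU1P[->|/df dj]; first by rewrite ge_min lexx.
by rewrite ge_min dj orbT.
Qed.

(** Finitely many balls of radius [r / 2] centered in the support cover it, each of positive mass;
    [ball u r] contains whichever of them contains [u]. *)
Lemma msupport_ball_lbound mu (r : R) : compact (msupport mu) -> 0 < r ->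
  exists2 k, 0 < k & forall u, msupport mu u -> (k%:E <= mu (ball u r))%E.
Proof.
move=> cK r0; have r20 : 0 < r / 2 by rewrite divr_gt0.
have mur u : mu (ball u (r / 2)) \is a fin_num.
  by apply: fin_num_measure; exact: measurable_ball.
move: cK; rewrite compact_cover.
move=> /(_ _ (msupport mu) (fun u => ball u (r / 2))).
case=> [u _|u Ku|D DK KD]; first exact: ball_open.
  by exists u => //; exact: ballxx.
have [u /DK/set_mem/(_ _ r20)|k k0 kD] :=
    @seq_pos_lbound _ (finmap.enum_fset D)
      (fun u => fine (mu (ball u (r / 2)))).
  by move=> mu0; rewrite fine_gt0// mu0 ltey_eq mur.
exists k => // u /KD[v /= vD uv].
rewrite (@le_trans _ _ (mu (ball v (r / 2))))//.
  by rewrite -[X in (_ <= X)%E]fineK// lee_fin kD.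
rewrite le_measure ?inE//; [exact: measurable_ball|exact: measurable_ball|].
move=> s vs; rewrite [r]splitr; apply: ball_triangle vs.
exact: ball_sym.
Qed.

(** The endpoints are the extreme values of the identity on [C]. *)
Lemma compact_connected_itv C : compact C -> connected C -> C !=set0 ->
  exists ab : R * R, ab.1 <= ab.2 /\ C = `[ab.1, ab.2]%classic.
Proof.
move=> cC /connected_intervalP iC C0.
have cid : {within C, continuous (@idfun R)}.
  by apply: continuous_subspaceT => x; exact: cvg_id.
have [a /set_mem Ca a_min] := compact_EVT_min C0 cC cid.
have [b /set_mem Cb b_max] := compact_EVT_max C0 cC cid.
have aC u : C u -> a <= u by move=> /mem_set; exact: a_min.
have bC u : C u -> u <= b by move=> /mem_set; exact: b_max.
exists (a, b); split; first exact: aC.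
apply/seteqP; split => u /=; rewrite in_itv/=.
  by move=> Cu; rewrite aC ?bC.
exact: iC.
Qed.

(** A component of a compact set is closed in it, hence a compact interval, and two components that
    meet coincide. *)
Lemma components_itv K n : compact K -> components K #= `I_n ->
  exists a b : nat -> R, [/\ forall j, (j < n)%N -> a j <= b j,
    forall i j, (i < n)%N -> (j < n)%N -> i != j ->
      `[a i, b i]%classic `&` `[a j, b j]%classic = set0 &
    K = \bigcup_(j in `I_n) `[a j, b j]%classic].
Proof.
move=> cK; rewrite card_eq_sym => /card_set_bijP[f [fun_f inj_f surj_f]].
have clK : closed K by apply: compact_closed => //; exact: Rhausdorff.
have /choice[ab fI] : forall j, exists ab : R * R, (j < n)%N ->
    ab.1 <= ab.2 /\ f j = `[ab.1, ab.2]%classic.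
  move=> j; have [jn|jn] := boolP (j < n)%N; last by exists (0, 0).
  have [t Kt ft] := fun_f _ jn.
  have [|||ab fj] := @compact_connected_itv (f j); last by exists ab.
  - rewrite -ft; apply: (subclosed_compact _ cK); first exact: component_closed.
    exact: connected_component_sub.
  - by rewrite -ft; exact: component_connected.
  - by exists t; rewrite -ft; exact: connected_component_refl.
exists (fst \o ab), (snd \o ab); split => [j /fI[]//|i j iN jN ij|].
  rewrite /= -(fI _ iN).2 -(fI _ jN).2.
  have [s Ks fs] := fun_f _ iN; have [t Kt ft] := fun_f _ jN.
  rewrite -subset0 => u []; rewrite -{1}fs -{1}ft.
  move=> /same_connected_component su /same_connected_component tu.
  by move/eqP: ij; apply; apply: inj_f; rewrite ?inE// -fs -ft su tu.
rewrite -[LHS]connected_component_cover; apply/seteqP; split => u.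
  move=> [C KC Cu]; have [j jn fj] := surj_f _ KC.
  exists j => //; have := (fI _ jn).2; rewrite fj => Cj.
  by rewrite -[X in X u]/(`[(ab j).1, (ab j).2]%classic) -Cj.
move=> [j jn]; rewrite -[X in X u]/(`[(ab j).1, (ab j).2]%classic).
rewrite -(fI _ jn).2 => fju.
by exists (f j) => //; exact: fun_f.
Qed.

Lemma enlarge_disjoint_itv (a b : nat -> R) n e : 0 < e ->
  (forall j, (j < n)%N -> a j <= b j) ->
  (forall i j, (i < n)%N -> (j < n)%N -> i != j ->
    `[a i, b i]%classic `&` `[a j, b j]%classic = set0) ->
  exists d, [/\ 0 < d, d <= e & forall i j, (i < n)%N -> (j < n)%N -> i != j ->
    `[a i - d, b i + d]%classic `&` `[a j - d, b j + d]%classic = set0].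
Proof.
move=> e0 ab dab.
(* Off the diagonal, [g] is the gap between the two intervals; the value [1] on the diagonal is a
   positive filler. *)
pose g (p : 'I_n * 'I_n) := if p.1 == p.2 then 1
  else Num.max (a p.2 - b p.1) (a p.1 - b p.2).
have [p _|d d0 dg] := @seq_pos_lbound _ (enum {: 'I_n * 'I_n}) g.
  rewrite /g; case: ifPn => // p12.
  have := dab p.1 p.2 (ltn_ord _) (ltn_ord _) p12.
  have := ab p.1 (ltn_ord _); have := ab p.2 (ltn_ord _).
  rewrite lt_max !subr_gt0 => a2 a1; apply: contraPT.
  rewrite negb_or -!leNgt => /andP[ba1 ba2].
  (* Were both differences nonpositive, the larger left endpoint would lie in both intervals. *)
  apply/eqP/set0P; exists (Num.max (a p.1) (a p.2)).
  by split; rewrite /= in_itv/= le_max lexx ge_max ?orbT/= ?a1 ?a2 ?ba1 ?ba2.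
exists (Num.min e (d / 3)); split.
- by rewrite lt_min e0 divr_gt0.
- by rewrite ge_min lexx.
move=> i j iN jN ij; rewrite -subset0 => t [].
rewrite /= !in_itv/=; set d' := Num.min _ _.
have d'd : d' <= d / 3 by rewrite ge_min lexx orbT.
have := dg (Ordinal iN, Ordinal jN); rewrite mem_enum /g => /(_ isT) /=.
rewrite -val_eqE/= (negbTE ij) le_max => /orP[] ? /andP[? ?] /andP[? ?]; lra.
Qed.

End topology_of_the_support.

(** * Spreading the mass of [mu] with a weight *)

Section smoothing.
Context {R : realType} (mu : probability R R) (w : R -> R) (r v M : R).
Context (mw : measurable_fun setT w) (w0 : forall t, 0 <= w t).
Context (wM : forall t, w t <= M) (r0 : 0 < r) (v0 : 0 < v).
Local Notation L := (@lebesgue_measure R).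
(* Lebesgue measure lives on [measurableTypeR R], which has the Borel sets of
   [R] but a different display. *)
Local Notation TR := (measurableTypeR R).

(** The cutoff is part of a function on the product, so that Tonelli applies to it. *)
Definition local_weight (p : R * TR) : R :=
  if `|p.1 - p.2| < r then w p.2 else 0.

Definition local_mass (u : R) : \bar R :=
  (\int[L]_t (local_weight (u, t))%:E)%E.

(* On the support of [mu] the maximum is the local mass; elsewhere it only keeps
   the kernel bounded. *)
Definition local_norm (u : R) : R := Num.max v (fine (local_mass u)).

(** For fixed [u], the density into which a unit mass at [u] is spread; its integral is [1] where
    the local mass is at least [v], and at most [1] everywhere. *)
Definition local_kernel (p : R * TR) : R :=
  (local_norm p.1)^-1 * local_weight p.

Definition smooth_density (t : R) : R :=
  fine (\int[mu]_u (local_kernel (u, t))%:E)%E.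

Lemma local_weight_ge0 p : 0 <= local_weight p.
Proof. by rewrite /local_weight; case: ifP. Qed.

Lemma measurable_local_weight : measurable_fun setT local_weight.
Proof.
apply: measurable_fun_ifT => //; last exact: measurableT_comp.
apply: measurable_fun_ltr => //; apply: measurableT_comp => //.
by apply: measurable_funB; [exact: measurable_fst|exact: measurable_snd].
Qed.

Lemma measurable_local_mass : measurable_fun setT local_mass.
Proof.
apply: (@measurable_fun_fubini_tonelli_F _ _ _ _ _ L (EFin \o local_weight)).
  by apply/measurable_EFinP; exact: measurable_local_weight.
by move=> p; rewrite lee_fin local_weight_ge0.
Qed.

Lemma local_mass_ge0 u : (0 <= local_mass u)%E.
Proof. by apply: integral_ge0 => t _; rewrite lee_fin local_weight_ge0. Qed.

Lemma local_massE u : local_mass u = (\int[L]_(t in ball u r) (w t)%:E)%E.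
Proof.
rewrite /local_mass [RHS]integral_mkcond; apply: eq_integral => t _.
rewrite /local_weight patchE /=; case: ifPn => ut; first by rewrite mem_set.
by rewrite memNset//; exact/negP.
Qed.

Lemma local_mass_le u : (local_mass u <= (r *+ 2 * M)%:E)%E.
Proof.
rewrite local_massE.
apply: (@le_trans _ _ (\int[L]_(t in ball u r) (cst M%:E t))%E).
  apply: ge0_le_integral => //.
  - exact: measurable_ball.
  - by move=> t _; rewrite lee_fin.
  - by apply/measurable_EFinP; exact: measurable_funTS.
  - by move=> t _; rewrite lee_fin.
rewrite integral_cst; last exact: measurable_ball.
by rewrite [X in (_ * X)%E](lebesgue_measure_ball u (ltW r0)) -EFinM mulrC.
Qed.

Lemma local_mass_fin_num u : local_mass u \is a fin_num.
Proof.
rewrite ge0_fin_numE ?local_mass_ge0//.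
by rewrite (le_lt_trans (local_mass_le u)) ?ltry.
Qed.

Lemma local_norm_gt0 u : 0 < local_norm u.
Proof. by rewrite lt_max v0. Qed.

Lemma local_norm_le u : local_norm u <= Num.max v (r *+ 2 * M).
Proof.
rewrite ge_max le_max lexx/= le_max -[fine _ <= r *+ 2 * M]lee_fin.
by rewrite fineK ?local_mass_fin_num// local_mass_le orbT.
Qed.

Lemma local_kernel_ge0 p : 0 <= local_kernel p.
Proof.
by rewrite mulr_ge0 ?local_weight_ge0// invr_ge0 ltW ?local_norm_gt0.
Qed.

Lemma measurable_local_kernel : measurable_fun setT local_kernel.
Proof.
apply: measurable_funM; last exact: measurable_local_weight.
apply: (@measurableT_comp _ _ _ _ _ _ (fun u => (local_norm u)^-1)) => //.
(* Since [v > 0], this function of [x] is nonincreasing on the whole line, hence measurable. *)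
apply: (@measurableT_comp _ _ _ _ _ _ (fun x => (Num.max v x)^-1)).
  apply: nonincreasing_measurable => // x y xy.
  by rewrite lef_pV2 ?posrE ?lt_max ?v0// ge_max !le_max lexx xy orbT.
by apply: measurableT_comp => //; exact: measurable_local_mass.
Qed.

Lemma local_kernel_le u t : local_kernel (u, t) <= v^-1 * w t.
Proof.
apply: ler_pM; rewrite ?local_weight_ge0 ?invr_ge0 ?(ltW (local_norm_gt0 _))//=.
  by rewrite lef_pV2 ?posrE ?local_norm_gt0// le_max lexx.
by rewrite /local_weight; case: ifP.
Qed.

Lemma measurable_local_kernel1 t :
  measurable_fun setT (fun u => (local_kernel (u, t))%:E).
Proof.
apply/measurable_EFinP.
exact: (measurable_fun_pair1 t measurable_local_kernel).
Qed.

Lemma integral_local_kernel_le t :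
  (\int[mu]_u (local_kernel (u, t))%:E <= (v^-1 * w t)%:E)%E.
Proof.
apply: (@le_trans _ _ (\int[mu]_u (cst (v^-1 * w t)%:E u))%E).
  apply: ge0_le_integral => //.
  - by move=> u _; rewrite lee_fin local_kernel_ge0.
  - exact: measurable_local_kernel1.
  - by move=> u _; rewrite lee_fin local_kernel_le.
by rewrite integral_cst// [X in (_ * X)%E]probability_setT mule1.
Qed.

Lemma smooth_densityE t :
  (smooth_density t)%:E = (\int[mu]_u (local_kernel (u, t))%:E)%E.
Proof.
rewrite fineK// ge0_fin_numE.
  by rewrite (le_lt_trans (integral_local_kernel_le t)) ?ltry.
by apply: integral_ge0 => u _; rewrite lee_fin local_kernel_ge0.
Qed.

Lemma smooth_density_ge0 t : 0 <= smooth_density t.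
Proof.
rewrite -lee_fin smooth_densityE; apply: integral_ge0 => u _.
by rewrite lee_fin local_kernel_ge0.
Qed.

Lemma measurable_smooth_density : measurable_fun setT smooth_density.
Proof.
apply/measurable_EFinP.
have := @measurable_fun_fubini_tonelli_G _ _ R TR R mu (EFin \o local_kernel).
rewrite (_ : EFin \o smooth_density = fubini_G mu (EFin \o local_kernel)).
  apply; first by apply/measurable_EFinP; exact: measurable_local_kernel.
  by move=> p; rewrite lee_fin local_kernel_ge0.
by apply/funext => t; exact: smooth_densityE.
Qed.

Lemma smooth_density_le t : smooth_density t <= v^-1 * w t.
Proof. by rewrite -lee_fin smooth_densityE integral_local_kernel_le. Qed.

(** Every [u] in [ball t r] has [t] within reach, and there the kernel is [w t] divided by a norm
    that [local_norm_le] bounds above. *)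
Lemma smooth_density_ge (t k : R) : 0 <= k -> (k%:E <= mu (ball t r))%E ->
  k / Num.max v (r *+ 2 * M) * w t <= smooth_density t.
Proof.
move=> k0 kt; set V := Num.max _ _.
have V0 : 0 < V by rewrite lt_max v0.
rewrite -lee_fin smooth_densityE.
apply: (@le_trans _ _ (\int[mu]_(u in ball t r) (cst (V^-1 * w t)%:E u))%E).
  rewrite integral_cst; last exact: measurable_ball.
  rewrite -mulrA EFinM muleC lee_wpmul2l// lee_fin mulr_ge0//.
  by rewrite invr_ge0 ltW.
rewrite [leLHS]integral_mkcond; apply: ge0_le_integral => //.
- move=> u _; rewrite patchE; case: ifP => // _.
  by rewrite lee_fin mulr_ge0// invr_ge0 ltW.
- apply/(measurable_restrictT _ _).1 => //; exact: measurable_ball.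
- exact: measurable_local_kernel1.
move=> u _; rewrite patchE; case: ifPn => [/set_mem tu|_]; last first.
  by rewrite lee_fin local_kernel_ge0.
rewrite lee_fin /local_kernel /local_weight/= ifT; last by rewrite distrC.
by rewrite ler_wpM2r// lef_pV2 ?posrE ?local_norm_gt0// local_norm_le.
Qed.

Lemma measurable_local_kernel2 u :
  measurable_fun setT (fun t : TR => (local_kernel (u, t))%:E).
Proof.
apply/measurable_EFinP.
exact: (measurable_fun_pair2 u measurable_local_kernel).
Qed.

Lemma integral_local_kernelE u :
  (\int[L]_t (local_kernel (u, t))%:E =
   ((local_norm u)^-1)%:E * local_mass u)%E.
Proof.
rewrite -ge0_integralZl//.
- apply/measurable_EFinP.
  exact: (measurable_fun_pair2 u measurable_local_weight).
- by move=> t _; rewrite lee_fin local_weight_ge0.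
- by rewrite lee_fin invr_ge0 ltW ?local_norm_gt0.
Qed.

Lemma integral_local_kernel_le1 u : (\int[L]_t (local_kernel (u, t))%:E <= 1)%E.
Proof.
rewrite integral_local_kernelE -[local_mass u]fineK ?local_mass_fin_num//.
rewrite -EFinM lee_fin ler_pdivrMl ?local_norm_gt0// mulr1.
by rewrite /local_norm le_max lexx orbT.
Qed.

Lemma integral_local_kernel_eq1 u : (v%:E <= local_mass u)%E ->
  (\int[L]_t (local_kernel (u, t))%:E = 1)%E.
Proof.
rewrite integral_local_kernelE -[local_mass u]fineK ?local_mass_fin_num//.
rewrite lee_fin -EFinM => vu; rewrite /local_norm (max_idPr vu) mulVf//.
by rewrite gt_eqF// (lt_le_trans v0).
Qed.

(** The indicator as a factor turns integrals over [A] into integrals over the whole line, the form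
    Tonelli needs. *)
Let kernel_in (A : set R) (p : R * TR) : \bar R :=
  ((local_kernel p)%:E * (\1_A p.2)%:E)%E.

Let measurable_kernel_in A : measurable A -> measurable_fun setT (kernel_in A).
Proof.
move=> mA; apply: emeasurable_funM.
  by apply/measurable_EFinP; exact: measurable_local_kernel.
have mA1 : measurable_fun setT (\1_A : TR -> R) by exact: measurable_indic.
by apply/measurable_EFinP; exact: (measurableT_comp mA1).
Qed.

Let kernel_in_ge0 A p : (0 <= kernel_in A p)%E.
Proof. by rewrite mule_ge0// lee_fin ?local_kernel_ge0. Qed.

Let integral_kernel_in A u :
  (\int[L]_t kernel_in A (u, t) = \int[L]_(t in A) (local_kernel (u, t))%:E)%E.
Proof.
rewrite [RHS]integral_mkcond; apply: eq_integral => t _.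
by rewrite /kernel_in patchE indicE; case: ifP; rewrite ?mule1 ?mule0.
Qed.

Lemma measurable_integral_local_kernel (A : set R) : measurable A ->
  measurable_fun setT (fun u => \int[L]_(t in A) (local_kernel (u, t))%:E)%E.
Proof.
move=> mA; rewrite (_ : (fun u => _) = fubini_F L (kernel_in A)).
  by apply: measurable_fun_fubini_tonelli_F => //; exact: measurable_kernel_in.
by apply/funext => u; rewrite -integral_kernel_in.
Qed.

Lemma integral_smooth_density (A : set R) : measurable A ->
  (\int[L]_(t in A) (smooth_density t)%:E =
   \int[mu]_u \int[L]_(t in A) (local_kernel (u, t))%:E)%E.
Proof.
move=> mA; transitivity (\int[L]_t \int[mu]_u kernel_in A (u, t))%E.
  rewrite integral_mkcond; apply: eq_integral => t _.
  have -> : (\int[mu]_u kernel_in A (u, t) =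
      (\int[mu]_u (local_kernel (u, t))%:E) * (\1_A t)%:E)%E.
    rewrite -ge0_integralZr//.
      exact: measurable_local_kernel1.
    by move=> u _; rewrite lee_fin local_kernel_ge0.
  by rewrite -smooth_densityE patchE indicE; case: ifP; rewrite ?mule1 ?mule0.
transitivity (\int[mu]_u \int[L]_t kernel_in A (u, t))%E.
  have mk := measurable_kernel_in _ mA.
  exact/esym/(@fubini_tonelli _ _ _ _ _ mu L _ mk (kernel_in_ge0 A)).
by apply: eq_integral => u _; exact: integral_kernel_in.
Qed.

(** Mass moves by less than [r]: only points [u] of [B] send mass into [A], and each sends at most
    its own. *)
Lemma integral_smooth_density_le (A B : set R) : measurable A -> measurable B ->
  (forall t u, A t -> `|u - t| < r -> B u) ->
  (\int[L]_(t in A) (smooth_density t)%:E <= mu B)%E.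
Proof.
move=> mA mB AB; rewrite integral_smooth_density//.
apply: (@le_trans _ _ (\int[mu]_u (\1_B u)%:E)%E); last first.
  by rewrite integral_indic// setIT.
apply: ge0_le_integral => //.
- move=> u _; apply: integral_ge0 => t _.
  by rewrite lee_fin local_kernel_ge0.
- exact: measurable_integral_local_kernel.
- by apply/measurable_EFinP; exact: measurable_indic.
move=> u _; rewrite indicE; have [Bu|Bu] := boolP (u \in B).
  rewrite (le_trans _ (integral_local_kernel_le1 u))//.
  apply: ge0_subset_integral => //.
    exact: measurable_local_kernel2.
  by move=> t _; rewrite lee_fin local_kernel_ge0.
rewrite integral0_eq// => t At; rewrite /local_kernel /local_weight/=.
rewrite ifF ?mulr0//; apply/negP => /(AB _ _ At).
by move: Bu; rewrite notin_setE.
Qed.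

(** After exchanging the integrals, the inner one is [1] for [mu]-almost every [u]. *)
Lemma integral_smooth_density1 K : mu.-negligible (~` K) ->
  (forall u, K u -> (v%:E <= local_mass u)%E) ->
  (\int[L]_t (smooth_density t)%:E = 1)%E.
Proof.
move=> K0 vK; rewrite integral_smooth_density//.
rewrite (ge0_ae_eq_integral _ _ (g := cst 1%E))//.
- by rewrite integral_cst// mul1e; exact: probability_setT.
- exact: measurable_integral_local_kernel.
- by move=> u _; apply: integral_ge0 => t _; rewrite lee_fin local_kernel_ge0.
- apply: negligibleS K0 => u /= uN Ku; apply: uN => _.
  by rewrite integral_local_kernel_eq1// vK.
Qed.

End smoothing.

(** * The probability with a given density *)

Section density_probability.
Context {R : realType} (rho : R -> R).
Context (mrho : measurable_fun setT rho) (rho0 : forall t, 0 <= rho t).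
Context (rho1 : (\int[lebesgue_measure]_t (rho t)%:E = 1)%E).

(** The proofs are arguments so that the term determines the measure and probability structures
    attached to it below. *)
Definition density_prob of measurable_fun setT rho & (forall t, 0 <= rho t) &
    (\int[lebesgue_measure]_t (rho t)%:E = 1)%E : set R -> \bar R :=
  fun A => (\int[lebesgue_measure]_(t in A) (rho t)%:E)%E.

Local Notation nu := (density_prob mrho rho0 rho1).

Let density_prob0 : nu set0 = 0%E.
Proof. by rewrite /density_prob integral_set0. Qed.

Let density_prob_ge0 A : (0 <= nu A)%E.
Proof. by apply: integral_ge0 => t _; rewrite lee_fin. Qed.

Let density_prob_sigma_additive : semi_sigma_additive nu.
Proof.
move=> /= F mF tF mUF; rewrite /density_prob; apply: cvg_toP.
  apply: ereal_nondecreasing_is_cvgn => m n mn.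
  by apply: lee_sum_nneg_natr => // k _ _; exact: density_prob_ge0.
rewrite ge0_integral_bigcup//=.
- by apply: measurable_funTS; apply/measurable_EFinP.
- by move=> t _; rewrite lee_fin.
Qed.

HB.instance Definition _ := isMeasure.Build _ _ _ nu
  density_prob0 density_prob_ge0 density_prob_sigma_additive.

HB.instance Definition _ := @Measure_isProbability.Build _ _ R nu rho1.

End density_probability.

(** * Semicircles and their sums *)

Section semicircle.
Context {R : realType}.
Implicit Types a b t : R.

(* [Num.sqrt] is [0] on negative numbers, so this vanishes outside [[a, b]]. *)
Definition semicircle a b t : R := Num.sqrt ((t - a) * (b - t)).

Lemma measurable_semicircle a b : measurable_fun setT (semicircle a b).
Proof.
have ms : measurable_fun setT (@Num.sqrt R).
  by apply: continuous_measurable_fun; exact: sqrt_continuous.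
rewrite /semicircle; apply: (measurableT_comp ms).
by apply: measurable_funM; apply: measurable_funB.
Qed.

Lemma semicircle_eq0 a b t : a <= b -> t \notin `[a, b] -> semicircle a b t = 0.
Proof.
move=> ab; rewrite in_itv/= negb_and -!ltNge => abt; apply: ler0_sqrtr.
by case/orP: abt => abt; [rewrite nmulr_rle0|rewrite nmulr_lle0]; lra.
Qed.

Lemma semicircle_le a b t : a <= b -> semicircle a b t <= b - a.
Proof.
move=> ab; have [|tab] := boolP (t \in `[a, b]); last first.
  by rewrite semicircle_eq0// subr_ge0.
rewrite in_itv/= => /andP[ta tb].
rewrite -[leRHS]ger0_norm ?subr_ge0// -sqrtr_sqr ler_wsqrtr//; nra.
Qed.

(** Both factors under the root are at least [d]. *)
Lemma semicircle_ge a b t d : 0 <= d -> a + d <= t -> t <= b - d ->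
  d <= semicircle a b t.
Proof.
move=> d0 ta tb; rewrite -[leLHS]ger0_norm// -sqrtr_sqr ler_wsqrtr//.
by rewrite expr2 ler_pM//; lra.
Qed.

End semicircle.

Section semicircle_sum.
Context {R : realType} (n : nat) (a b : nat -> R).
Context (ab : forall j, (j < n)%N -> a j <= b j).

Definition semicircles (t : R) : R := \sum_(j < n) semicircle (a j) (b j) t.

Lemma semicircles_ge0 t : 0 <= semicircles t.
Proof. by apply: sumr_ge0 => j _; exact: sqrtr_ge0. Qed.

Lemma measurable_semicircles : measurable_fun setT semicircles.
Proof. by apply: measurable_sum => j; exact: measurable_semicircle. Qed.

Lemma semicircles_le t : semicircles t <= \sum_(j < n) (b j - a j).
Proof. by apply: ler_sum => j _; rewrite semicircle_le// ab. Qed.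

Lemma semicircle_le_sum t j : (j < n)%N ->
  semicircle (a j) (b j) t <= semicircles t.
Proof.
move=> jn; rewrite /semicircles (bigD1 (Ordinal jn))//= lerDl.
by apply: sumr_ge0 => i _; exact: sqrtr_ge0.
Qed.

Lemma semicircles_eq0 t : (forall j, (j < n)%N -> t \notin `[a j, b j]) ->
  semicircles t = 0.
Proof.
by move=> tab; apply: big1 => j _; rewrite semicircle_eq0 ?ab// tab.
Qed.

Lemma semicirclesE t j : (j < n)%N -> t \in `[a j, b j] ->
  (forall i j, (i < n)%N -> (j < n)%N -> i != j ->
    `[a i, b i]%classic `&` `[a j, b j]%classic = set0) ->
  semicircles t = semicircle (a j) (b j) t.
Proof.
move=> jn tj dab; rewrite /semicircles (bigD1 (Ordinal jn))//= big1 ?addr0//.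
move=> i ij; rewrite semicircle_eq0 ?ab//; apply/negP => ti.
by have : set0 t by rewrite -(dab i j _ jn).
Qed.

End semicircle_sum.

(** * Construction of [x] and [y] and verification of the bounds *)

Theorem lemma2p2 (R : realType) (mu : probability R R) (n : nat) :
  compact (msupport mu) ->
  components (msupport mu) #= `I_n ->
  forall eps : R, 0 < eps ->
  exists x y : R -> R,
    [/\ is_Linf01 x, is_Linf01 y,
        (Linf01 (fun t => (x t - y t)%R) < eps%:E)%E,
        (forall A, measurable A -> distr01 x A = mu A) &
        (exists (a b c C : nat -> R) (rho : R -> R),
          [/\ (forall j, (j < n)%N -> a j < b j /\ 0 < c j /\ 0 < C j),
              (forall i j, (i < n)%N -> (j < n)%N -> i != j ->
                 `[a i, b i]%classic `&` `[a j, b j]%classic = set0),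
              msupport (distr01 y) `<=` \bigcup_(j in `I_n) `[a j, b j]%classic,
              [/\ measurable_fun setT rho, (forall t, 0 <= rho t) &
               (forall A, measurable A ->
                 distr01 y A = (\int[lebesgue_measure]_(t in A) (rho t)%:E)%E)] &
              (forall j, (j < n)%N -> forall t, t \in `[a j, b j] ->
                 c j * Num.sqrt ((t - a j) * (b j - t)) <= rho t /\
                 rho t <= C j * Num.sqrt ((t - a j) * (b j - t)))])].

Proof.
move=> cK Kn eps eps0; set K := msupport mu in cK Kn.
(* Halving turns the bound [<= r] on the quantiles into the strict [< eps]. *)
pose r := eps / 2; have r0 : 0 < r by rewrite divr_gt0.
have [al [be [albe dis KE]]] := components_itv _ _ cK Kn.
(* With [d <= r / 2], a ball of radius [r / 2] around a point within [d] of [t] stays in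
   [ball t r]. *)
have [d [d0 dr dis_d]] : exists d : R, [/\ 0 < d, d <= r / 2 &
    forall i j, (i < n)%N -> (j < n)%N -> i != j ->
    `[al i - d, be i + d]%classic `&` `[al j - d, be j + d]%classic = set0].
  by apply: enlarge_disjoint_itv => //; rewrite divr_gt0.
pose a j := al j - d; pose b j := be j + d.
have ab j : (j < n)%N -> a j < b j by move=> /albe; rewrite /a /b; lra.
have ab' j : (j < n)%N -> a j <= b j by move=> /ab /ltW.
pose w := semicircles n a b; pose M := \sum_(j < n) (b j - a j).
(* For [u] in [K], [w] is at least [d / 2] on the ball of radius [d / 2] around [u], whose length is
   [d / 2 *+ 2]; the product bounds the local mass below. *)
pose v : R := (d / 2) * (d / 2 *+ 2).
have v0 : 0 < v by rewrite mulr_gt0 ?mulrn_wgt0 ?divr_gt0.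
have mw : measurable_fun setT w by exact: measurable_semicircles.
have w0 t : 0 <= w t by exact: semicircles_ge0.
have wM t : w t <= M by exact: semicircles_le.
have vK u : K u -> (v%:E <= local_mass w r u)%E.
  rewrite KE => -[j jn]; rewrite /= in_itv/= => /andP[ua ub].
  rewrite local_massE.
  apply: (@le_trans _ _ (\int[lebesgue_measure]_(t in ball u (d / 2))
      (cst (d / 2)%:E t))%E).
    rewrite integral_cst; last exact: measurable_ball.
    by rewrite [X in (_ * X)%E]lebesgue_measure_ball// ltW// divr_gt0.
  apply: (@le_trans _ _ (\int[lebesgue_measure]_(t in ball u (d / 2))
      (w t)%:E)%E).
    apply: ge0_le_integral => //.
    - exact: measurable_ball.
    - by move=> t _; rewrite lee_fin divr_ge0// ltW.
    - by apply/measurable_EFinP; exact: measurable_funTS.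
    move=> t; rewrite ball_itv/= in_itv/= => /andP[ut tu]; rewrite lee_fin.
    apply: (le_trans _ (semicircle_le_sum _ _ _ _ _ jn)).
    by apply: semicircle_ge; rewrite /a /b; lra.
  apply: ge0_subset_integral.
  - exact: measurable_ball.
  - exact: measurable_ball.
  - by apply/measurable_EFinP; exact: measurable_funTS.
  - by move=> t _; rewrite lee_fin.
  - by apply: le_ball; lra.
pose rho := smooth_density mu w r v.
have mrho : measurable_fun setT rho by exact: measurable_smooth_density.
have rho0 t : 0 <= rho t by exact: smooth_density_ge0.
have rho1 : (\int[lebesgue_measure]_t (rho t)%:E = 1)%E.
  have K0 := negligible_setC_msupport mu.
  exact: (integral_smooth_density1 _ _ _ _ M _ _ _ _ _ K).
pose nu : probability R R := density_prob rho mrho rho0 rho1.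
have nu_le (A B : set R) : measurable A -> measurable B ->
    (forall t u, A t -> `|u - t| < r -> B u) -> (nu A <= mu B)%E.
  exact: (integral_smooth_density_le _ _ _ _ M).
(* [nu_le] bounds [nu] by [mu] only, so this direction passes to complements: [nu ]s + r, +oo[] is
   at most [mu ]s, +oo[]. *)
have munu s : (mu `]-oo, s]%classic <= nu `]-oo, (s + r)%R]%classic)%E.
  have PC (P : probability R R) x :
      P `]-oo, x]%classic = (1 - P `]x, +oo[%classic)%E.
    by rewrite -setCitvr; exact: probability_setC.
  rewrite !PC leeB// nu_le// => t u /=; rewrite !in_itv/= !andbT => ts.
  by rewrite ltr_norml => /andP[ru _]; lra.
have numu s : (nu `]-oo, s]%classic <= mu `]-oo, (s + r)%R]%classic)%E.
  apply: nu_le => // t u /=; rewrite !in_itv/= => ts.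
  by rewrite ltr_norml => /andP[_ ur]; lra.
have xy u : 0 < u < 1 -> `|quantile mu u - quantile nu u| <= r.
  by move=> u01; exact: quantile_dist.
have [B KB] : exists B, K `<=` `[- B, B]%classic.
  (* Compactness gives a bound by every real above [B], hence [B + 1]. *)
  have [B [_ KB]] := compact_bounded cK; exists (B + 1) => u Ku /=.
  by rewrite in_itv/= -ler_norml; apply: KB => //; rewrite ltrDl.
have xB u : 0 < u < 1 -> `|quantile mu u| <= B.
  move=> u01; apply: quantile_norm_le => //.
  apply: negligibleS (negligible_setC_msupport mu).
  by apply: subsetC; exact: KB.
have [k k0 kK] : exists2 k : R, 0 < k &
    forall u, K u -> (k%:E <= mu (ball u (r / 2)))%E.
  by apply: msupport_ball_lbound => //; rewrite divr_gt0.
exists (quantile mu), (quantile nu); split.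
- split; first exact: measurable_quantile.
  by rewrite (le_lt_trans (Linf01_le _ _ xB)) ?ltry.
- split; first exact: measurable_quantile.
  rewrite (le_lt_trans (Linf01_le _ (r + B) _)) ?ltry// => u u01.
  rewrite -[quantile nu u](subrK (quantile mu u)) (le_trans (ler_normD _ _))//.
  by rewrite lerD ?xB// distrC xy.
- by rewrite (le_lt_trans (Linf01_le _ _ xy))// lte_fin /r; lra.
- exact: quantile_distr.
(* The constants are the same for all [j]: [v] bounds every [local_norm] below, the maximum bounds
   it above, and [k] is the least mass available near [t]. *)
exists a, b, (fun=> k / Num.max v (r *+ 2 * M)), (fun=> v^-1), rho; split.
- move=> j jn; split; first exact: ab.
  by rewrite invr_gt0 divr_gt0// lt_max v0.
- exact: dis_d.
- move=> t; apply: contraPP => tU.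
  have clU : closed (\bigcup_(j in `I_n) `[a j, b j]%classic).
    by apply: closed_bigcup => [|j _]; [exact: finite_II|exact: itv_closed].
  have /nbhs_ballP[e /= e0 eU] :
      nbhs t (~` \bigcup_(j in `I_n) `[a j, b j]%classic).
    by apply: open_nbhs_nbhs; split => //; exact: closed_openC.
  move=> /(_ _ e0); rewrite quantile_distr; last exact: measurable_ball.
  rewrite [X in (_ < X)%E](_ : _ = 0%E) ?ltxx//.
  (* Off the union [w] vanishes, and [rho] with it by its upper bound. *)
  apply: integral0_eq => s /eU sU; congr EFin; apply/le_anti/andP; split => //.
  rewrite (le_trans (smooth_density_le mu _ r _ mw w0 v0 s))//.
  rewrite [w s]semicircles_eq0 ?mulr0// => j jn.
  by apply/negP => sj; apply: sU; exists j.
- by split=> // A mA; rewrite quantile_distr.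
- move=> j jn t tj; rewrite -/(semicircle (a j) (b j) t).
  rewrite -(semicirclesE _ _ _ ab' _ _ jn tj dis_d).
  split; last exact: smooth_density_le.
  apply: (smooth_density_ge _ _ _ _ M) => //; first exact: ltW.
  (* The witness is the point of [[al j, be j]] nearest to [t]. *)
  have [u Ku tu] : exists2 u, K u & `|t - u| <= d.
    move: tj; rewrite in_itv/= /a /b => /andP[ta tb]; have := albe _ jn => ?.
    exists (if t < al j then al j else if be j < t then be j else t).
      rewrite KE; exists j => //=; rewrite in_itv/=.
      by case: ltP => ?; [|case: ltP => ?]; apply/andP; split; lra.
    rewrite ler_norml.
    by case: ltP => ?; [|case: ltP => ?]; apply/andP; split; lra.
  apply: (le_trans (kK _ Ku)).
  rewrite le_measure ?inE//; [exact: measurable_ball|exact: measurable_ball|].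
  move=> s /= us; rewrite /ball/= (le_lt_trans (ler_distD u t s))//.
  by rewrite /ball/= in us; lra.
Qed.
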